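(* $$\frac{96\sqrt2}{7}=\sum_{j=0}^{\infty}\left(-\frac14\right)^{j}\frac{\left(\frac54\right)_j\left(\frac{11}{8}\right)_j\left(\frac{15}{8}\right)_j}{(1)_j\left(\frac74\right)_j\left(\frac74\right)_j}\,(40j+33).$$
   Context: $(x)_0=1$ and $(x)_j=x(x+1)\cdots(x+j-1)$ for positive integers $j$ (rising factorial). *)

(* Defs.v *)
From Stdlib Require Import Reals.
From Coquelicot Require Import Coquelicot.
Open Scope R_scope.

(* Rising factorial (x)_j = x (x + 1) ... (x + j - 1), with (x)_0 = 1. *)
Fixpoint rising (x : R) (j : nat) : R :=
  match j with
  | O => 1
  | S k => rising x k * (x + INR k)
  end.

(* Main.v *)
Require Import Defs.
From Stdlib Require Import Reals Lra Lia.
From Coquelicot Require Import Coquelicot.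
Open Scope R_scope.

(** The series is the accelerated form of the well-poised alternating series
      Omega_0 = sum_k (-1)^k (5/4 + 2k) (5/4)_k (-1/4)_k^2 / (k! (5/2)_k^2),
    and both the acceleration and the evaluation of Omega_0 are done with
    Wilf-Zeilberger pairs.

    Acceleration.  [accel j k] is the summand of the same well-poised series
    with the parameters 5/4, 5/4 of Omega_0 moved to 5/4 + 2j, 5/4 + j, times
    a prefactor depending on j alone.  The certificate [accel_cert] satisfies
      accel j k - accel (j+1) k = accel_cert j k - accel_cert j (k+1)
    and vanishes as k grows, so consecutive sums over k differ by
    [accel_cert j 0], which is one sixteenth of the j-th term of the theorem
    ([accel_cert_0]).  Since [accel] shrinks by 13/16 at each step in j
    ([accel_contract]), the sums over k tend to 0, and adding up the
    differences gives sum_j accel_cert j 0 = Omega_0.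

    Evaluation.  Omega_0 is 5/4 times the sum of [wellpoised 0], where
    [wellpoised n k] moves both parameters 5/4 to 5/4 + n, divides the linear
    factor by 5/4 + n and is scaled by [gamma_ratio n] so that a second certificate, now vanishing at k = 0 too,
    shows that the sum over k is independent of n.  As n grows only the term
    k = 0 survives, so the sum is the limit of [gamma_ratio], which is
    Gamma(5/2)^2 / (Gamma(9/4) Gamma(11/4)) = 24 sqrt 2 / 35.  This limit
    needs no Gamma function: by duplication [gamma_ratio] is 48/35 times
    w_(2m) / w_m with w_m = (1/2)_m / m! = binomial(2m,m) / 4^m, and
    w_m sqrt m has a positive limit.

    Hence the sum is 16 * (5/4) * 24 sqrt 2 / 35 = 96 sqrt 2 / 7. *)

(** * Rising factorials *)

Lemma rising_S (x : R) (k : nat) : rising x (S k) = rising x k * (x + INR k).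
Proof. reflexivity. Qed.

Lemma rising_pos (x : R) (k : nat) : 0 < x -> 0 < rising x k.
Proof.
  intros Hx; induction k as [|k IH]; [simpl; lra|].
  rewrite rising_S; apply Rmult_lt_0_compat; [exact IH|].
  pose proof (pos_INR k); lra.
Qed.

Lemma rising_le (x y : R) (k : nat) :
  0 < x -> x <= y -> rising x k <= rising y k.
Proof.
  intros Hx Hxy; induction k as [|k IH]; [simpl; lra|].
  rewrite !rising_S; pose proof (pos_INR k).
  apply Rmult_le_compat; [left; now apply rising_pos | lra | exact IH | lra].
Qed.

Lemma rising_shift (x : R) (k : nat) : x * rising (x + 1) k = rising x (S k).
Proof.
  induction k as [|k IH]; [simpl; ring|].
  rewrite (rising_S x (S k)), <- IH, rising_S, S_INR; ring.
Qed.

Lemma rising_double (x : R) (j : nat) :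
  rising x (2 * j) = 4 ^ j * rising (x / 2) j * rising ((x + 1) / 2) j.
Proof.
  induction j as [|j IH]; [simpl; ring|].
  replace (2 * S j)%nat with (S (S (2 * j))) by lia.
  rewrite !rising_S, IH, S_INR, mult_INR; simpl; field.
Qed.

(** * Telescoping between series *)

Lemma is_series_of_remainder (a r : nat -> R) (s : R) :
  (forall n, sum_n a n = s - r n) -> is_lim_seq r 0 -> is_series a s.
Proof.
  intros Hsum Hr.
  change (is_lim_seq (sum_n a) s).
  apply (is_lim_seq_ext (fun n => s - r n)); [intros n; now rewrite Hsum|].
  replace (Finite s) with (Finite (s - 0)) by (f_equal; ring).
  apply is_lim_seq_minus'; [apply is_lim_seq_const|exact Hr].
Qed.

(** The pair relation, summed over k, leaves only the boundary term g(0). *)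
Lemma wz_series_diff (f f' g : nat -> R) :
  (forall k, f k - f' k = g k - g (S k)) ->
  ex_series f -> ex_series f' -> is_lim_seq g 0 ->
  Series f - Series f' = g O.
Proof.
  intros Hfg Hf Hf' Hg.
  rewrite <- Series_minus by assumption.
  apply is_series_unique.
  assert (Hsum : forall n, sum_n (fun k => f k - f' k) n = g O - g (S n)).
  { induction n as [|n IH]; [rewrite sum_O; apply Hfg|].
    rewrite sum_Sn, IH, Hfg; unfold plus; simpl; ring. }
  apply (is_series_of_remainder _ (fun n => g (S n))); [exact Hsum|].
  now apply (is_lim_seq_incr_1 g).
Qed.

Lemma ex_series_Rmult_l (c : R) (a : nat -> R) :
  ex_series a -> ex_series (fun n => c * a n).
Proof. exact (ex_series_scal (V := R_NormedModule) c a). Qed.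

Lemma is_lim_seq_inv_shift (c : R) : is_lim_seq (fun n => / (INR n + c)) 0.
Proof.
  replace (Finite 0) with (Rbar_inv p_infty) by reflexivity.
  apply is_lim_seq_inv; [|discriminate].
  apply (is_lim_seq_plus _ _ p_infty c p_infty);
    [apply is_lim_seq_INR | apply is_lim_seq_const | reflexivity].
Qed.

Lemma is_series_inv_consecutive :
  is_series (fun k => / ((INR k + 1) * (INR k + 2))) 1.
Proof.
  assert (Hsum : forall n,
    sum_n (fun k => / ((INR k + 1) * (INR k + 2))) n = 1 - / (INR n + 2)).
  { induction n as [|n IH]; [rewrite sum_O; simpl; field|].
    rewrite sum_Sn, IH, S_INR; unfold plus; simpl.
    pose proof (pos_INR n); field; lra. }
  apply (is_series_of_remainder _ _ _ Hsum).
  apply is_lim_seq_inv_shift.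
Qed.

Lemma is_lim_seq_abs_le (u v : nat -> R) :
  (forall n, Rabs (u n) <= v n) -> is_lim_seq v 0 -> is_lim_seq u 0.
Proof.
  intros Huv Hv; apply is_lim_seq_abs_0.
  apply (is_lim_seq_le_le (fun _ => 0) _ v); [|apply is_lim_seq_const|exact Hv].
  intros n; split; [apply Rabs_pos | apply Huv].
Qed.

(** * The limit of the Gamma quotient *)

(** This is binomial(2m,m) / 4^m. *)
Definition central (m : nat) : R := rising (1 / 2) m / rising 1 m.

Lemma central_pos (m : nat) : 0 < central m.
Proof. apply Rdiv_lt_0_compat; apply rising_pos; lra. Qed.

Lemma central_S (m : nat) :
  central (S m) = central m * ((INR m + 1 / 2) / (INR m + 1)).
Proof.
  unfold central; rewrite !rising_S.
  pose proof (pos_INR m); pose proof (rising_pos 1 m Rlt_0_1).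
  field; lra.
Qed.

(** Wallis without pi: w_m^2 (m + 1/2) decreases while w_m^2 m increases and
    equals 1/4 at m = 1, so the former has a limit, which is positive. *)
Lemma central_sqr_cvg :
  exists l, 0 < l /\ is_lim_seq (fun m => central m ^ 2 * (INR m + 1 / 2)) l.
Proof.
  set (v := fun m => central m ^ 2 * (INR m + 1 / 2)).
  assert (Hdecr : forall m, v (S m) <= v m).
  { intros m; unfold v; rewrite central_S, S_INR.
    pose proof (pos_INR m); pose proof (pow2_ge_0 (central m)).
    replace ((central m * ((INR m + 1 / 2) / (INR m + 1))) ^ 2 * (INR m + 1 + 1 / 2))
      with (central m ^ 2 * (INR m + 1 / 2) *
        (1 - / (4 * (INR m + 1) ^ 2))) by (field; lra).
    assert (0 < / (4 * (INR m + 1) ^ 2)) by (apply Rinv_0_lt_compat; nra).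
    assert (0 <= central m ^ 2 * (INR m + 1 / 2)) by (apply Rmult_le_pos; lra).
    nra. }
  assert (Hlow : forall m, 1 / 4 <= central (S m) ^ 2 * INR (S m)).
  { induction m as [|m IH].
    - unfold central; simpl; lra.
    - eapply Rle_trans; [exact IH|].
      rewrite (central_S (S m)), (S_INR (S m)).
      assert (Hm : 0 < INR (S m)) by (apply lt_0_INR; lia).
      revert Hm; generalize (INR (S m)); intros x Hx.
      replace ((central (S m) * ((x + 1 / 2) / (x + 1))) ^ 2 * (x + 1))
        with (central (S m) ^ 2 * x * (1 + / (4 * x * (x + 1)))) by (field; lra).
      assert (0 < / (4 * x * (x + 1))) by (apply Rinv_0_lt_compat; nra).
      pose proof (pow2_ge_0 (central (S m))).
      assert (0 <= central (S m) ^ 2 * x) by (apply Rmult_le_pos; lra).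
      nra. }
  assert (Hge : forall m, 1 / 4 <= v m).
  { intros [|m]; unfold v.
    - unfold central; simpl; lra.
    - pose proof (Hlow m); pose proof (pow2_ge_0 (central (S m))); nra. }
  destruct (ex_finite_lim_seq_decr v (1 / 4) Hdecr Hge) as [l Hl].
  exists l; split; [|exact Hl].
  assert (H := is_lim_seq_le _ _ _ _ Hge (is_lim_seq_const (1 / 4)) Hl).
  simpl in H; lra.
Qed.

(** With v_m = w_m^2 (m + 1/2) converging to a positive limit, v_(2m) / v_m
    tends to 1, and (w_(2m) / w_m)^2 is that quotient times
    (m + 1/2) / (2m + 1/2). *)
Lemma central_double_cvg :
  is_lim_seq (fun m => central (2 * m) / central m) (sqrt 2 / 2).
Proof.
  destruct central_sqr_cvg as [l [Hl Hv]].
  set (v := fun m => central m ^ 2 * (INR m + 1 / 2)) in Hv.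
  assert (Hv2 : is_lim_seq (fun m => v (2 * m)%nat) l).
  { apply (is_lim_seq_subseq v l (fun m => (2 * m)%nat)); [|exact Hv].
    apply eventually_subseq; intros n; lia. }
  assert (Hq : is_lim_seq (fun m => (1 + / 4 * / (INR m + 1 / 4)) / 2) (1 / 2)).
  { replace (Finite (1 / 2)) with (Finite ((1 + / 4 * 0) * / 2)) by (f_equal; field).
    apply is_lim_seq_mult'; [|apply is_lim_seq_const].
    apply is_lim_seq_plus'; [apply is_lim_seq_const|].
    apply is_lim_seq_mult'; [apply is_lim_seq_const | apply is_lim_seq_inv_shift]. }
  assert (Hsq : is_lim_seq (fun m => (central (2 * m) / central m) ^ 2) (1 / 2)).
  { apply (is_lim_seq_ext (fun m => v (2 * m)%nat / v m * ((1 + / 4 * / (INR m + 1 / 4)) / 2))).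
    - intros m; unfold v; rewrite mult_INR; simpl (INR 2).
      pose proof (pos_INR m); pose proof (central_pos m).
      field; lra.
    - replace (Finite (1 / 2)) with (Finite (l / l * (1 / 2))) by (f_equal; field; lra).
      apply is_lim_seq_mult'; [|exact Hq].
      apply is_lim_seq_div'; [exact Hv2 | exact Hv | lra]. }
  replace (sqrt 2 / 2) with (sqrt (1 / 2)).
  - apply (is_lim_seq_ext (fun m => sqrt ((central (2 * m) / central m) ^ 2))).
    + intros m; apply sqrt_pow2.
      left; apply Rdiv_lt_0_compat; apply central_pos.
    + apply (is_lim_seq_continuous sqrt); [|exact Hsq].
      apply continuity_pt_sqrt; lra.
  - rewrite <- (sqrt_pow2 (sqrt 2 / 2)).
    + f_equal. assert (H := sqrt_sqrt 2 ltac:(lra)). simpl; nra.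
    + pose proof (sqrt_pos 2); lra.
Qed.

(** Its limit is Gamma(5/2)^2 / (Gamma(9/4) Gamma(11/4)). *)
Definition gamma_ratio (n : nat) : R :=
  rising (9 / 4) n * rising (11 / 4) n / rising (5 / 2) n ^ 2.

Lemma gamma_ratio_pos (n : nat) : 0 < gamma_ratio n.
Proof.
  apply Rdiv_lt_0_compat; [apply Rmult_lt_0_compat|apply pow_lt];
    apply rising_pos; lra.
Qed.

Lemma gamma_ratio_S (n : nat) :
  gamma_ratio (S n) =
  gamma_ratio n * ((9 / 4 + INR n) * (11 / 4 + INR n) / (5 / 2 + INR n) ^ 2).
Proof.
  unfold gamma_ratio; rewrite !rising_S.
  pose proof (pos_INR n); pose proof (rising_pos (5 / 2) n ltac:(lra)).
  field; lra.
Qed.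

(** Shifting all the parameters down by 2 turns the quotient into
    (1/4)_m (3/4)_m / (1/2)_m^2 with m = n + 2, where duplication applies:
    (1/4)_m (3/4)_m = (1/2)_(2m) / 4^m and (1)_(2m) = 4^m (1/2)_m (1)_m. *)
Lemma gamma_ratio_central (n : nat) :
  gamma_ratio n = 48 / 35 * (central (2 * (n + 2)) / central (n + 2)).
Proof.
  replace (n + 2)%nat with (S (S n)) by lia.
  unfold central, gamma_ratio.
  rewrite !rising_double.
  replace (1 / 2 / 2) with (1 / 4) by field.
  replace ((1 / 2 + 1) / 2) with (3 / 4) by field.
  replace ((1 + 1) / 2) with 1 by field.
  assert (H2 : forall x, x <> 0 -> rising x (S (S n)) = x * (x + 1) * rising (x + 2) n).
  { intros x Hx; rewrite <- rising_shift, <- rising_shift.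
    replace (x + 1 + 1) with (x + 2) by ring; ring. }
  pose proof (rising_pos 1 (S (S n)) ltac:(lra)).
  pose proof (rising_pos (5 / 2) n ltac:(lra)).
  pose proof (pow_lt 4 (S (S n)) ltac:(lra)).
  rewrite (H2 (1 / 4)), (H2 (3 / 4)), (H2 (1 / 2)) by lra.
  replace (1 / 4 + 2) with (9 / 4) by field.
  replace (3 / 4 + 2) with (11 / 4) by field.
  replace (1 / 2 + 2) with (5 / 2) by field.
  field; lra.
Qed.

Lemma gamma_ratio_cvg : is_lim_seq gamma_ratio (24 * sqrt 2 / 35).
Proof.
  apply (is_lim_seq_ext
    (fun n => 48 / 35 * (central (2 * (n + 2)) / central (n + 2)))).
  - intros n; now rewrite gamma_ratio_central.
  - replace (Finite (24 * sqrt 2 / 35)) with (Finite (48 / 35 * (sqrt 2 / 2)))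
      by (f_equal; field).
    apply is_lim_seq_mult'; [apply is_lim_seq_const|].
    apply (is_lim_seq_incr_n (fun m => central (2 * m) / central m) 2).
    exact central_double_cvg.
Qed.

(** * Evaluation of the well-poised series *)

Definition wellpoised (n k : nat) : R :=
  gamma_ratio n * (-1) ^ k * ((5 / 4 + INR n + 2 * INR k) / (5 / 4 + INR n)) *
  (rising (5 / 4 + INR n) k * rising (- (1 / 4)) k ^ 2 /
   (rising 1 k * rising (5 / 2 + INR n) k ^ 2)).

(** Gosper's algorithm applied to wellpoised n k - wellpoised (n+1) k. *)
Definition wellpoised_cert (n k : nat) : R :=
  wellpoised n k * (INR k / (5 / 4 + INR n + 2 * INR k)).

Lemma wellpoised_S_n (n k : nat) :
  wellpoised (S n) k = wellpoised n k *
    ((11 / 4 + INR n) * (9 / 4 + INR n + 2 * INR k) * (5 / 4 + INR n + INR k) /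
     ((5 / 4 + INR n + 2 * INR k) * (5 / 2 + INR n + INR k) ^ 2)).
Proof.
  unfold wellpoised; rewrite gamma_ratio_S, S_INR.
  pose proof (pos_INR n); pose proof (pos_INR k).
  assert (Hs : forall x, 0 < x -> rising (x + 1) k = rising x k * (x + INR k) / x).
  { intros x Hx; apply (Rmult_eq_reg_l x); [|lra].
    rewrite rising_shift, rising_S; field; lra. }
  replace (5 / 4 + (INR n + 1)) with (5 / 4 + INR n + 1) by ring.
  replace (5 / 2 + (INR n + 1)) with (5 / 2 + INR n + 1) by ring.
  rewrite !Hs by lra.
  pose proof (rising_pos 1 k ltac:(lra)).
  pose proof (rising_pos (5 / 2 + INR n) k ltac:(lra)).
  field; lra.
Qed.

Lemma wellpoised_S_k (n k : nat) :
  wellpoised n (S k) = - wellpoised n k *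
    ((5 / 4 + INR n + 2 * INR k + 2) * (5 / 4 + INR n + INR k) * (INR k - 1 / 4) ^ 2 /
     ((5 / 4 + INR n + 2 * INR k) * (1 + INR k) * (5 / 2 + INR n + INR k) ^ 2)).
Proof.
  unfold wellpoised; rewrite !rising_S, S_INR, <- tech_pow_Rmult.
  pose proof (pos_INR n); pose proof (pos_INR k).
  pose proof (rising_pos 1 k ltac:(lra)).
  pose proof (rising_pos (5 / 2 + INR n) k ltac:(lra)).
  field; lra.
Qed.

Lemma wellpoised_telescope (n k : nat) :
  wellpoised n k - wellpoised (S n) k = wellpoised_cert n k - wellpoised_cert n (S k).
Proof.
  unfold wellpoised_cert; rewrite wellpoised_S_n, wellpoised_S_k, S_INR.
  pose proof (pos_INR n); pose proof (pos_INR k).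
  field; lra.
Qed.

Lemma rising_quarter_le_fact (k : nat) :
  Rabs (rising (- (1 / 4)) k) * (INR k + 1) <= rising 1 k.
Proof.
  induction k as [|k IH]; [simpl; rewrite Rabs_R1; lra|].
  rewrite !rising_S, Rabs_mult, S_INR.
  pose proof (pos_INR k); pose proof (Rabs_pos (rising (- (1 / 4)) k)).
  assert (Hk : Rabs (- (1 / 4) + INR k) * (INR k + 2) <= (INR k + 1) ^ 2).
  { unfold Rabs; destruct (Rcase_abs _); nra. }
  replace (INR k + 1 + 1) with (INR k + 2) by ring.
  rewrite Rmult_assoc.
  eapply Rle_trans; [apply Rmult_le_compat_l; [assumption|exact Hk]|].
  nra.
Qed.

Lemma rising_quarter_le_five_halves (k : nat) :
  Rabs (rising (- (1 / 4)) k) * (INR k + 1) ^ 2 <= rising (5 / 2) k.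
Proof.
  induction k as [|k IH]; [simpl; rewrite Rabs_R1; lra|].
  rewrite !rising_S, Rabs_mult, S_INR.
  pose proof (pos_INR k); pose proof (Rabs_pos (rising (- (1 / 4)) k)).
  assert (Hk : Rabs (- (1 / 4) + INR k) * (INR k + 1 + 1) ^ 2
               <= (INR k + 1) ^ 2 * (5 / 2 + INR k)).
  { destruct k as [|k]; [simpl; unfold Rabs; destruct (Rcase_abs _); lra|].
    rewrite S_INR in *; pose proof (pos_INR k).
    rewrite Rabs_pos_eq by lra; nra. }
  rewrite Rmult_assoc.
  eapply Rle_trans; [apply Rmult_le_compat_l; [assumption|exact Hk]|].
  nra.
Qed.

(** Four elementary bounds, one for each factor of the summand, combine to a
    decay of 1/k^2.  The gain in n comes from the first factor 5/2 + n of
    (5/2 + n)_(k+1); this is why the term k = 0 is left out. *)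
Lemma wellpoised_tail_le (n k : nat) :
  Rabs (wellpoised n (S k)) <=
  gamma_ratio n * (5 / (INR n + 1)) * / ((INR k + 1) * (INR k + 2)).
Proof.
  pose proof (pos_INR n) as Hn; pose proof (pos_INR k) as Hk.
  pose proof (gamma_ratio_pos n) as HL.
  pose proof (rising_quarter_le_fact (S k)) as H1.
  pose proof (rising_quarter_le_five_halves (S k)) as H2.
  pose proof (rising_le (5 / 4 + INR n) (5 / 2 + INR n) (S k) ltac:(lra) ltac:(lra)) as H3.
  pose proof (rising_pos (5 / 4 + INR n) (S k) ltac:(lra)) as P3.
  pose proof (rising_pos (5 / 2 + INR n) (S k) ltac:(lra)) as P4.
  pose proof (rising_pos 1 (S k) ltac:(lra)) as P1.
  assert (H4 : rising (5 / 2) (S k) * (5 / 2 + INR n) <= rising (5 / 2 + INR n) (S k) * (5 / 2)).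
  { rewrite <- !rising_shift.
    pose proof (rising_le (5 / 2 + 1) (5 / 2 + INR n + 1) k ltac:(lra) ltac:(lra)).
    nra. }
  unfold wellpoised.
  rewrite S_INR in *.
  set (x := Rabs (rising (- (1 / 4)) (S k))) in *.
  assert (Hx : 0 <= x) by apply Rabs_pos.
  replace (rising (- (1 / 4)) (S k) ^ 2) with (x ^ 2) by apply pow2_abs.
  rewrite !Rabs_mult, pow_1_abs.
  rewrite (Rabs_pos_eq (gamma_ratio n)) by lra.
  rewrite (Rabs_pos_eq (_ / (5 / 4 + INR n)))
    by (apply Rlt_le, Rdiv_lt_0_compat; lra).
  rewrite (Rabs_pos_eq (_ / (_ * _ ^ 2)))
    by (apply Rle_mult_inv_pos; [apply Rmult_le_pos; [lra | apply pow2_ge_0]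
                                | apply Rmult_lt_0_compat; [lra | apply pow_lt; lra]]).
  revert P1 P3 P4 H1 H2 H3 H4 Hx HL Hn Hk.
  generalize (gamma_ratio n) (rising 1 (S k)) (rising (5 / 4 + INR n) (S k))
    (rising (5 / 2 + INR n) (S k)) (rising (5 / 2) (S k)).
  generalize x (INR n) (INR k); clear.
  intros x n k L p1 p3 p4 p2 P1 P3 P4 H1 H2 H3 H4 Hx HL Hn Hk.
  assert (A1 : (5 / 4 + n + 2 * (k + 1)) / (5 / 4 + n) <= 2 * (k + 2)).
  { apply Rle_div_l; nra. }
  assert (A2 : x / p1 <= / (k + 2)).
  { apply Rle_div_l; [lra|]. apply (Rmult_le_reg_r (k + 2)); [lra|].
    replace (/ (k + 2) * p1 * (k + 2)) with p1 by (field; lra). lra. }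
  assert (A3 : p3 / p4 <= 1) by (apply Rle_div_l; lra).
  assert (A4 : x / p4 <= 5 / 2 / (n + 1) * / (k + 2) ^ 2).
  { apply Rle_div_l; [lra|].
    apply (Rmult_le_reg_r ((n + 1) * (k + 2) ^ 2)); [nra|].
    replace (5 / 2 / (n + 1) * / (k + 2) ^ 2 * p4 * ((n + 1) * (k + 2) ^ 2))
      with (p4 * (5 / 2)) by (field; lra).
    eapply Rle_trans; [|exact H4].
    replace (k + 1 + 1) with (k + 2) in H2 by ring.
    assert (0 <= x * (k + 2) ^ 2) by (apply Rmult_le_pos; nra).
    nra. }
  assert (B1 : 0 <= (5 / 4 + n + 2 * (k + 1)) / (5 / 4 + n))
    by (apply Rlt_le, Rdiv_lt_0_compat; lra).
  assert (B2 : 0 <= x / p1) by (apply Rle_mult_inv_pos; lra).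
  assert (B3 : 0 <= p3 / p4) by (apply Rle_mult_inv_pos; lra).
  assert (B4 : 0 <= x / p4) by (apply Rle_mult_inv_pos; lra).
  replace (p3 * x ^ 2 / (p1 * p4 ^ 2)) with (x / p1 * (p3 / p4) * (x / p4)) by (field; lra).
  replace (L * 1 * ((5 / 4 + n + 2 * (k + 1)) / (5 / 4 + n)) * (x / p1 * (p3 / p4) * (x / p4)))
    with (L * (((5 / 4 + n + 2 * (k + 1)) / (5 / 4 + n)) * (x / p1) * (p3 / p4) * (x / p4)))
    by ring.
  apply (Rle_trans _ (L * (2 * (k + 2) * / (k + 2) * 1 * (5 / 2 / (n + 1) * / (k + 2) ^ 2)))).
  - apply Rmult_le_compat_l; [lra|].
    apply Rmult_le_compat; [ | exact B4 | | exact A4].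
    { apply Rmult_le_pos; [apply Rmult_le_pos|]; assumption. }
    apply Rmult_le_compat; [apply Rmult_le_pos; assumption | exact B3 | | exact A3].
    apply Rmult_le_compat; assumption.
  - replace (L * (2 * (k + 2) * / (k + 2) * 1 * (5 / 2 / (n + 1) * / (k + 2) ^ 2)))
      with (L * (5 / (n + 1)) * / (k + 2) ^ 2) by (field; lra).
    apply Rmult_le_compat_l.
    + apply Rmult_le_pos; [lra|]. apply Rlt_le, Rdiv_lt_0_compat; lra.
    + apply Rinv_le_contravar; nra.
Qed.

Lemma ex_series_wellpoised_abs (n : nat) : ex_series (fun k => Rabs (wellpoised n k)).
Proof.
  apply ex_series_incr_1.
  apply (ex_series_le (K := R_AbsRing) (V := R_CompleteNormedModule) _
    (fun k => gamma_ratio n * (5 / (INR n + 1)) * / ((INR k + 1) * (INR k + 2)))).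
  - intros k; unfold norm; simpl; unfold abs; simpl.
    rewrite Rabs_Rabsolu; apply wellpoised_tail_le.
  - apply ex_series_Rmult_l.
    eexists; exact is_series_inv_consecutive.
Qed.

Lemma ex_series_wellpoised (n : nat) : ex_series (wellpoised n).
Proof. apply ex_series_Rabs, ex_series_wellpoised_abs. Qed.

(** The boundary term of the telescoping vanishes because [wellpoised_cert]
    has a factor k. *)
Lemma Series_wellpoised_S (n : nat) : Series (wellpoised (S n)) = Series (wellpoised n).
Proof.
  assert (H : Series (wellpoised n) - Series (wellpoised (S n)) = wellpoised_cert n O).
  { apply wz_series_diff;
      [apply wellpoised_telescope | apply ex_series_wellpoised
      | apply ex_series_wellpoised |].
    apply (is_lim_seq_abs_le _ (fun k => Rabs (wellpoised n k))).
    - intros k; unfold wellpoised_cert; rewrite Rabs_mult.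
      pose proof (pos_INR n); pose proof (pos_INR k); pose proof (Rabs_pos (wellpoised n k)).
      assert (Hle : Rabs (INR k / (5 / 4 + INR n + 2 * INR k)) <= 1).
      { rewrite Rabs_pos_eq; [apply Rle_div_l; lra|].
        apply Rle_mult_inv_pos; lra. }
      nra.
    - apply ex_series_lim_0, ex_series_wellpoised_abs. }
  unfold wellpoised_cert in H; simpl (INR 0) in H; unfold Rdiv in H.
  rewrite Rmult_0_l, Rmult_0_r in H; lra.
Qed.

(** The constant sum differs from its first term gamma_ratio n by O(1/n), so
    it is the limit of [gamma_ratio]. *)
Lemma Series_wellpoised_0 : Series (wellpoised 0) = 24 * sqrt 2 / 35.
Proof.
  assert (Hconst : forall n, Series (wellpoised n) = Series (wellpoised 0)).
  { induction n as [|n IH]; [reflexivity|]. now rewrite Series_wellpoised_S. }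
  assert (Hhead : forall n, Rabs (Series (wellpoised 0) - gamma_ratio n)
                            <= gamma_ratio n * (5 / (INR n + 1))).
  { intros n; rewrite <- (Hconst n).
    rewrite (Series_incr_1 (wellpoised n)) by apply ex_series_wellpoised.
    assert (H0 : wellpoised n 0 = gamma_ratio n).
    { unfold wellpoised; simpl; pose proof (pos_INR n); field; lra. }
    rewrite H0.
    replace (gamma_ratio n + Series (fun k => wellpoised n (S k)) - gamma_ratio n)
      with (Series (fun k => wellpoised n (S k))) by ring.
    eapply Rle_trans.
    - apply Series_Rabs.
      apply (ex_series_incr_1 (fun k => Rabs (wellpoised n k))), ex_series_wellpoised_abs.
    - replace (gamma_ratio n * (5 / (INR n + 1)))
        with (gamma_ratio n * (5 / (INR n + 1)) *
              Series (fun k => / ((INR k + 1) * (INR k + 2))))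
        by (rewrite (is_series_unique _ _ is_series_inv_consecutive); ring).
      rewrite <- Series_scal_l.
      apply Series_le.
      + intros k; split; [apply Rabs_pos | apply wellpoised_tail_le].
      + apply ex_series_Rmult_l.
        eexists; exact is_series_inv_consecutive. }
  assert (Hinv : is_lim_seq (fun n => gamma_ratio n * (5 / (INR n + 1))) 0).
  { replace (Finite 0) with (Finite (24 * sqrt 2 / 35 * (5 * 0))) by (f_equal; ring).
    apply is_lim_seq_mult'; [exact gamma_ratio_cvg|].
    apply is_lim_seq_mult'; [apply is_lim_seq_const|].
    apply is_lim_seq_inv_shift. }
  assert (Hdiff := is_lim_seq_abs_le _ _ Hhead Hinv).
  assert (H := is_lim_seq_plus' _ _ _ _ Hdiff gamma_ratio_cvg).
  apply (is_lim_seq_ext _ (fun _ => Series (wellpoised 0))) in H; [|intros n; ring].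
  apply is_lim_seq_unique in H; rewrite Lim_seq_const in H.
  injection H as H; lra.
Qed.

(** * Acceleration *)

Definition accel (j k : nat) : R :=
  (-1) ^ (j + k) * (5 / 4 + 2 * INR j + 2 * INR k) *
  (rising (5 / 4) (j + k) * rising (- (1 / 4)) k ^ 2 *
   rising (5 / 4) j ^ 2 * rising (11 / 4) (2 * j) /
   (rising 1 (j + k) * rising (5 / 2) (2 * j + k) ^ 2)).

(** The numerator of the Gosper certificate for accel j k - accel (j+1) k, a
    cubic found by solving the telescoping equation for its coefficients.  At
    k = 0 it factors as (40 j + 33) (5/2 + 2j)^2 / 16, which is where the
    linear factor of the theorem comes from. *)
Definition accel_num (j k : R) : R :=
  825 / 64 + 20 * k + 31 / 4 * k ^ 2 + k ^ 3 +
  (145 / 4 + 36 * k + 7 * k ^ 2) * j + (133 / 4 + 16 * k) * j ^ 2 + 10 * j ^ 3.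

Definition accel_cert (j k : nat) : R :=
  accel j k * (accel_num (INR j) (INR k) /
    ((5 / 4 + 2 * INR j + 2 * INR k) * (5 / 2 + 2 * INR j + INR k) ^ 2)).

Lemma accel_S_j (j k : nat) :
  accel (S j) k = - accel j k *
    ((13 / 4 + 2 * INR j + 2 * INR k) * (5 / 4 + INR j + INR k) * (5 / 4 + INR j) ^ 2 *
     (11 / 4 + 2 * INR j) * (15 / 4 + 2 * INR j) /
     ((5 / 4 + 2 * INR j + 2 * INR k) * (1 + INR j + INR k) *
      (5 / 2 + 2 * INR j + INR k) ^ 2 * (7 / 2 + 2 * INR j + INR k) ^ 2)).
Proof.
  unfold accel.
  replace (S j + k)%nat with (S (j + k)) by lia.
  replace (2 * S j + k)%nat with (S (S (2 * j + k))) by lia.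
  replace (2 * S j)%nat with (S (S (2 * j))) by lia.
  rewrite !rising_S, <- tech_pow_Rmult, !S_INR, !plus_INR, !mult_INR.
  simpl (INR 2).
  pose proof (pos_INR j); pose proof (pos_INR k).
  pose proof (rising_pos 1 (j + k) ltac:(lra)).
  pose proof (rising_pos (5 / 2) (2 * j + k) ltac:(lra)).
  field; lra.
Qed.

Lemma accel_S_k (j k : nat) :
  accel j (S k) = - accel j k *
    ((13 / 4 + 2 * INR j + 2 * INR k) * (5 / 4 + INR j + INR k) * (INR k - 1 / 4) ^ 2 /
     ((5 / 4 + 2 * INR j + 2 * INR k) * (1 + INR j + INR k) *
      (5 / 2 + 2 * INR j + INR k) ^ 2)).
Proof.
  unfold accel.
  replace (j + S k)%nat with (S (j + k)) by lia.
  replace (2 * j + S k)%nat with (S (2 * j + k)) by lia.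
  rewrite !rising_S, <- tech_pow_Rmult, !S_INR, !plus_INR, !mult_INR.
  simpl (INR 2).
  pose proof (pos_INR j); pose proof (pos_INR k).
  pose proof (rising_pos 1 (j + k) ltac:(lra)).
  pose proof (rising_pos (5 / 2) (2 * j + k) ltac:(lra)).
  field; lra.
Qed.

Lemma accel_telescope (j k : nat) :
  accel j k - accel (S j) k = accel_cert j k - accel_cert j (S k).
Proof.
  unfold accel_cert, accel_num; rewrite accel_S_j, accel_S_k, S_INR.
  pose proof (pos_INR j); pose proof (pos_INR k).
  field; lra.
Qed.

(** Duplication brings (11/4)_(2j) and (5/2)_(2j) to single-step factorials,
    and the factor (5/4)_j of (5/2)_(2j) cancels against the numerator. *)
Lemma accel_cert_0 (j : nat) :
  accel_cert j 0 =
  / 16 * ((- (1 / 4)) ^ j *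
   ((rising (5 / 4) j * rising (11 / 8) j * rising (15 / 8) j) /
    (rising 1 j * rising (7 / 4) j * rising (7 / 4) j)) *
   (40 * INR j + 33)).
Proof.
  unfold accel_cert, accel, accel_num.
  rewrite !Nat.add_0_r, !rising_double.
  replace ((- (1 / 4)) ^ j) with ((-1) ^ j * / 4 ^ j)
    by (rewrite <- pow_inv, <- Rpow_mult_distr; f_equal; field).
  replace (11 / 4 / 2) with (11 / 8) by field.
  replace ((11 / 4 + 1) / 2) with (15 / 8) by field.
  replace (5 / 2 / 2) with (5 / 4) by field.
  replace ((5 / 2 + 1) / 2) with (7 / 4) by field.
  simpl (INR 0); simpl (rising _ 0).
  pose proof (pos_INR j).
  pose proof (rising_pos 1 j ltac:(lra)).
  pose proof (rising_pos (5 / 4) j ltac:(lra)).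
  pose proof (rising_pos (7 / 4) j ltac:(lra)).
  pose proof (pow_lt 4 j ltac:(lra)).
  field; lra.
Qed.

Lemma accel_0 (k : nat) : accel 0 k = 5 / 4 * wellpoised 0 k.
Proof.
  unfold accel, wellpoised, gamma_ratio; simpl (INR 0).
  replace (2 * 0 + k)%nat with k by lia.
  simpl (2 * 0)%nat; simpl (0 + k)%nat; simpl (rising _ 0).
  rewrite !Rplus_0_r.
  pose proof (rising_pos 1 k ltac:(lra)).
  pose proof (rising_pos (5 / 2) k ltac:(lra)).
  field; lra.
Qed.

(** The ratio of the two terms splits into four factors, bounded by 13/5, 5/4,
    1/4 and 1. *)
Lemma accel_contract (j k : nat) : Rabs (accel (S j) k) <= 13 / 16 * Rabs (accel j k).
Proof.
  rewrite accel_S_j, Rabs_mult, Rabs_Ropp, Rmult_comm.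
  apply Rmult_le_compat_r; [apply Rabs_pos|].
  pose proof (pos_INR j) as Hj; pose proof (pos_INR k) as Hk.
  revert Hj Hk; generalize (INR j) (INR k); clear; intros j k Hj Hk.
  assert (A1 : (13 / 4 + 2 * j + 2 * k) / (5 / 4 + 2 * j + 2 * k) <= 13 / 5)
    by (apply Rle_div_l; lra).
  assert (A2 : (5 / 4 + j + k) / (1 + j + k) <= 5 / 4)
    by (apply Rle_div_l; lra).
  assert (A3 : (5 / 4 + j) ^ 2 / (5 / 2 + 2 * j + k) ^ 2 <= 1 / 4)
    by (apply Rle_div_l; nra).
  assert (A4 : (11 / 4 + 2 * j) * (15 / 4 + 2 * j) / (7 / 2 + 2 * j + k) ^ 2 <= 1)
    by (apply Rle_div_l; nra).
  assert (B1 : 0 <= (13 / 4 + 2 * j + 2 * k) / (5 / 4 + 2 * j + 2 * k))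
    by (apply Rle_mult_inv_pos; lra).
  assert (B2 : 0 <= (5 / 4 + j + k) / (1 + j + k))
    by (apply Rle_mult_inv_pos; lra).
  assert (B3 : 0 <= (5 / 4 + j) ^ 2 / (5 / 2 + 2 * j + k) ^ 2)
    by (apply Rle_mult_inv_pos; nra).
  assert (B4 : 0 <= (11 / 4 + 2 * j) * (15 / 4 + 2 * j) / (7 / 2 + 2 * j + k) ^ 2)
    by (apply Rle_mult_inv_pos; nra).
  match goal with |- Rabs ?e <= _ => replace e with
    ((13 / 4 + 2 * j + 2 * k) / (5 / 4 + 2 * j + 2 * k) *
     ((5 / 4 + j + k) / (1 + j + k)) *
     ((5 / 4 + j) ^ 2 / (5 / 2 + 2 * j + k) ^ 2) *
     ((11 / 4 + 2 * j) * (15 / 4 + 2 * j) / (7 / 2 + 2 * j + k) ^ 2))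
    by (field; lra) end.
  rewrite Rabs_pos_eq
    by (apply Rmult_le_pos; [apply Rmult_le_pos; [apply Rmult_le_pos|]|]; assumption).
  replace (13 / 16) with (13 / 5 * (5 / 4) * (1 / 4) * 1) by field.
  apply Rmult_le_compat; [ | exact B4 | | exact A4].
  { apply Rmult_le_pos; [apply Rmult_le_pos|]; assumption. }
  apply Rmult_le_compat; [apply Rmult_le_pos; assumption | exact B3 | | exact A3].
  apply Rmult_le_compat; assumption.
Qed.

Lemma accel_geom (j k : nat) : Rabs (accel j k) <= (13 / 16) ^ j * Rabs (accel 0 k).
Proof.
  induction j as [|j IH]; [simpl; lra|].
  eapply Rle_trans; [apply accel_contract|]. simpl; lra.
Qed.

Lemma ex_series_accel_0_abs : ex_series (fun k => Rabs (accel 0 k)).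
Proof.
  apply (ex_series_ext (fun k => 5 / 4 * Rabs (wellpoised 0 k))).
  - intros k; rewrite accel_0, Rabs_mult, (Rabs_pos_eq (5 / 4)) by lra; reflexivity.
  - apply ex_series_Rmult_l; apply ex_series_wellpoised_abs.
Qed.

Lemma ex_series_accel_abs (j : nat) : ex_series (fun k => Rabs (accel j k)).
Proof.
  apply (ex_series_le (K := R_AbsRing) (V := R_CompleteNormedModule) _
    (fun k => (13 / 16) ^ j * Rabs (accel 0 k))).
  - intros k; unfold norm; simpl; unfold abs; simpl.
    rewrite Rabs_Rabsolu; apply accel_geom.
  - apply ex_series_Rmult_l; apply ex_series_accel_0_abs.
Qed.

Lemma ex_series_accel (j : nat) : ex_series (accel j).
Proof. apply ex_series_Rabs, ex_series_accel_abs. Qed.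

Lemma Series_accel_cvg_0 : is_lim_seq (fun j => Series (accel j)) 0.
Proof.
  apply (is_lim_seq_abs_le _
    (fun j => (13 / 16) ^ j * Series (fun k => Rabs (accel 0 k)))).
  - intros j; eapply Rle_trans; [apply Series_Rabs, ex_series_accel_abs|].
    rewrite <- Series_scal_l; apply Series_le.
    + intros k; split; [apply Rabs_pos | apply accel_geom].
    + apply ex_series_Rmult_l; apply ex_series_accel_0_abs.
  - replace (Finite 0) with (Finite (0 * Series (fun k => Rabs (accel 0 k))))
      by (f_equal; ring).
    apply is_lim_seq_mult'; [|apply is_lim_seq_const].
    apply is_lim_seq_geom; rewrite Rabs_pos_eq; lra.
Qed.

(** In the quotient accel_cert / accel numerator and denominator are both cubic
    in (j, k), and the coefficients of the denominator are all positive, so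
    the quotient is bounded for j, k >= 0. *)
Lemma accel_cert_le (j k : nat) : Rabs (accel_cert j k) <= 10 * Rabs (accel j k).
Proof.
  unfold accel_cert; rewrite Rabs_mult, Rmult_comm.
  apply Rmult_le_compat_r; [apply Rabs_pos|].
  pose proof (pos_INR j) as Hj; pose proof (pos_INR k) as Hk.
  revert Hj Hk; generalize (INR j) (INR k); clear; intros j k Hj Hk.
  assert (H2 : 0 <= j * k) by nra.
  assert (H3 : 0 <= j * k * k) by nra.
  assert (H4 : 0 <= j * j * k) by nra.
  assert (H5 : 0 <= j * j) by nra.
  assert (H6 : 0 <= k * k) by nra.
  assert (H7 : 0 <= k * k * k) by nra.
  assert (H8 : 0 <= j * j * j) by nra.
  assert (0 < (5 / 4 + 2 * j + 2 * k) * (5 / 2 + 2 * j + k) ^ 2)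
    by (apply Rmult_lt_0_compat; nra).
  unfold accel_num; rewrite Rabs_pos_eq.
  - apply Rle_div_l; nra.
  - apply Rle_mult_inv_pos; nra.
Qed.

Lemma Series_accel_S (j : nat) : Series (accel j) - Series (accel (S j)) = accel_cert j 0.
Proof.
  apply wz_series_diff; [apply accel_telescope | apply ex_series_accel | apply ex_series_accel |].
  apply (is_lim_seq_abs_le _ (fun k => 10 * Rabs (accel j k))); [apply accel_cert_le|].
  replace (Finite 0) with (Finite (10 * 0)) by (f_equal; ring).
  apply is_lim_seq_mult'; [apply is_lim_seq_const|].
  apply ex_series_lim_0, ex_series_accel_abs.
Qed.

Lemma is_series_accel_cert : is_series (fun j => accel_cert j 0) (Series (accel 0)).
Proof.
  assert (Hsum : forall n,
    sum_n (fun j => accel_cert j 0) n = Series (accel 0) - Series (accel (S n))).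
  { induction n as [|n IH]; [rewrite sum_O, Series_accel_S; reflexivity|].
    rewrite sum_Sn, IH, <- Series_accel_S; unfold plus; simpl; ring. }
  apply (is_series_of_remainder _ _ _ Hsum).
  apply (is_lim_seq_incr_1 (fun j => Series (accel j))), Series_accel_cvg_0.
Qed.

Theorem mainTheorem9 :
  is_series
    (fun j : nat =>
       (- (1 / 4)) ^ j *
       ((rising (5 / 4) j * rising (11 / 8) j * rising (15 / 8) j) /
        (rising 1 j * rising (7 / 4) j * rising (7 / 4) j)) *
       (40 * INR j + 33))
    (96 * sqrt 2 / 7).
Proof.
  replace (96 * sqrt 2 / 7) with (16 * Series (accel 0)).
  - apply (is_series_ext (fun j => 16 * accel_cert j 0)).
    + intros j; rewrite accel_cert_0, <- Rmult_assoc, Rinv_r, Rmult_1_l by lra.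
      reflexivity.
    + exact (is_series_scal (V := R_NormedModule) 16 _ _ is_series_accel_cert).
  - rewrite (Series_ext _ _ accel_0), Series_scal_l, Series_wellpoised_0; field.
Qed.
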